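(* Suppose $(G,g)\subset(G^{\mathbb C},g^{\mathbb C})$ is a pseudo-Riemannian Lie group which is a real slice of Lie groups, with $g$ of signature $(p,q)$. Assume there exist two Cartan involutions $\theta_1,\theta_2$ of $\mathfrak g$ (with respect to $g$). Then $\theta_1$ is conjugate to $\theta_2$ in $\mathrm{Aut}(\mathfrak g)_0\cap O(p,q)_0$, i.e. there is $\phi\in \mathrm{Aut}(\mathfrak g)_0\cap O(p,q)_0$ with $\phi\theta_1\phi^{-1}=\theta_2$.
   Context: A pseudo-Riemannian Lie group $(G,g)$ is a real Lie group $G$ with a left-invariant pseudo-Riemannian metric, identified with a symmetric non-degenerate bilinear form $g$ on the Lie algebra $\mathfrak g$. A holomorphic Riemannian Lie group $(G^{\mathbb C},g^{\mathbb C})$ is a complex Lie group with a left-invariant holomorphic metric, i.e. a symmetric non-degenerate complex bilinear form $g^{\mathbb C}$ on its complex Lie algebra $\mathfrak g^{\mathbb C}$. A real slice of Lie groups $(G,g)\subset(G^{\mathbb C},g^{\mathbb C})$ is a real Lie group $G$ with an immersive homomorphism of real Lie groups $G\to G^{\mathbb C}$ whose differential embeds $\mathfrak g$ as a real form of $\mathfrak g^{\mathbb C}$, such that $g^{\mathbb C}$ is real valued and non-degenerate on $\mathfrak g$ and $g=g^{\mathbb C}|_{\mathfrak g}$. $O(p,q)$ denotes the isometry group of $(\mathfrak g,g)$, $\mathrm{Aut}(\mathfrak g)$ the group of Lie algebra automorphisms, and a subscript $0$ denotes the identity component. A Cartan involution of $\mathfrak g$ (with respect to $g$) is a Lie algebra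 homomorphism $\theta:\mathfrak g\to\mathfrak g$ with $\theta^2=1$ (the identity is allowed), which is an isometry of $g$, and such that $g(\cdot,\theta(\cdot))$ is positive definite. *)

(* Defs.v *)
From HB Require Import structures.
From mathcomp Require Import all_boot all_order all_algebra.
From mathcomp Require Import all_classical all_reals all_analysis.
From mathcomp Require Import complex.

Set Implicit Arguments.
Unset Strict Implicit.
Unset Printing Implicit Defensive.

Import Order.TTheory GRing.Theory Num.Theory.
Import numFieldNormedType.Exports.

Local Open Scope classical_set_scope.
Local Open Scope ring_scope.
Local Open Scope complex_scope.

(** Smooth maps over [K]. Differentiability is taken over [K], so for a
    complex [K] these are the holomorphic maps. *)

Fixpoint Ck {K : numFieldType} {E F : normedModType K} (k : nat)
    (U : set E) (f : E -> F) : Prop :=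
  if k is k'.+1 then
    (forall x, U x -> differentiable f x) /\ (forall v, Ck k' U ('D_v f))
  else forall x, U x -> {for x, continuous f}.

Definition smooth_on {K : numFieldType} {E F : normedModType K}
    (U : set E) (f : E -> F) : Prop :=
  forall k, Ck k U f.

Record chart (K : numFieldType) (n : nat) (G : topologicalType) := Chart {
  chart_map :> G -> 'cV[K]_n;
  chart_inv : 'cV[K]_n -> G;
  chart_dom : set G;
  chart_dom_open : open chart_dom;
  chart_tgt_open : open (chart_map @` chart_dom);
  chart_mapK : forall x, chart_dom x -> chart_inv (chart_map x) = x;
  chart_map_cont : forall x, chart_dom x -> {for x, continuous chart_map};
  chart_inv_cont : forall y, (chart_map @` chart_dom) y ->
    {for y, continuous chart_inv} }.

Definition chart_tgt {K : numFieldType} {n : nat} {G : topologicalType}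
    (c : chart K n G) : set 'cV[K]_n :=
  c @` chart_dom c.

(** [n]-dimensional Lie groups over [K]: real Lie groups for a real [K],
    complex Lie groups for [K = R[i]]. The field [chart1] fixes a chart around
    the identity, which identifies the tangent space there with ['cV[K]_n]. *)

HB.mixin Record isLieGroup (K : numFieldType) (n : nat) (G : Type)
    of Group G & Topological G := {
  lie_hausdorff : hausdorff_space G;
  lie_second_countable : @second_countable G;
  lie_mul_continuous : continuous (fun p : G * G => (p.1 * p.2)%g);
  lie_inv_continuous : continuous (fun x : G => (x^-1)%g);
  atlas : set (chart K n G);
  atlas_cover : forall x : G, exists2 c, atlas c & chart_dom c x;
  atlas_compatible : forall a b, atlas a -> atlas b ->
    smooth_on (a @` (chart_dom a `&` chart_dom b)) (b \o chart_inv a);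
  lie_mul_smooth : forall a b c, atlas a -> atlas b -> atlas c ->
    smooth_on
      [set p : 'cV[K]_n * 'cV[K]_n | [/\ chart_tgt a p.1, chart_tgt b p.2 &
        chart_dom c (chart_inv a p.1 * chart_inv b p.2)%g]]
      (fun p => c (chart_inv a p.1 * chart_inv b p.2)%g);
  lie_inv_smooth : forall a b, atlas a -> atlas b ->
    smooth_on [set x | chart_tgt a x /\ chart_dom b ((chart_inv a x)^-1)%g]
      (fun x => b ((chart_inv a x)^-1)%g);
  chart1 : chart K n G;
  chart1_atlas : atlas chart1;
  chart1_dom : chart_dom chart1 (1%g : G) }.

#[short(type="lieGroupType")]
HB.structure Definition LieGroup (K : numFieldType) (n : nat) :=
  { G of Group G & Topological G & isLieGroup K n G }.

Section LieAlgebra.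
Variables (K : numFieldType) (n : nat) (G : lieGroupType K n).

Definition mul_local (p : 'cV[K]_n * 'cV[K]_n) : 'cV[K]_n :=
  (chart1 : chart K n G) (chart_inv chart1 p.1 * chart_inv chart1 p.2 : G)%g.

Definition coord1 : 'cV[K]_n := (chart1 : chart K n G) 1%g.

(** In a chart [c] around [1] with [c 1 = 0] the product of [G] reads
    [x + y + B x y + o(|x|^2 + |y|^2)] with [B] bilinear, and the bracket of
    left-invariant vector fields is [B u v - B v u]. The form [B] is the mixed
    second derivative of the product. *)
Definition mixed_mul (u v : 'cV[K]_n) : 'cV[K]_n :=
  'D_(u, 0) ('D_(0, v) mul_local) (coord1, coord1).

Definition lie_bracket (u v : 'cV[K]_n) : 'cV[K]_n :=
  mixed_mul u v - mixed_mul v u.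

(** Endomorphisms are matrices acting on column vectors. *)
Definition lie_hom (A : 'M[K]_n) : Prop :=
  forall u v, lie_bracket (A *m u) (A *m v) = A *m lie_bracket u v.

Definition lie_aut : set 'M[K]_n :=
  [set A | A \in unitmx /\ lie_hom A].

End LieAlgebra.

Section Forms.
Variables (K : numFieldType) (n : nat) (g : {biscalar 'cV[K]_n}).

(** A left-invariant (pseudo-Riemannian or holomorphic) metric, given by its
    value at the identity. *)
Definition is_metric : Prop :=
  (forall u v, g u v = g v u) /\ (forall u, (forall v, g u v = 0) -> u = 0).

Definition is_isometry (A : 'M[K]_n) : Prop :=
  forall u v, g (A *m u) (A *m v) = g u v.

Definition isometry_group : set 'M[K]_n :=
  [set A | A \in unitmx /\ is_isometry A].

(** There is an orthonormal basis, the columns of [P], with [p] vectors of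
    square [1] and [q] of square [-1]. *)
Definition has_signature (p q : nat) : Prop :=
  (p + q = n)%N /\ exists2 P : 'M[K]_n, P \in unitmx &
    forall i j : 'I_n, g (col i P) (col j P) =
      if i == j then (if (i < p)%N then 1 else -1) else 0.

End Forms.

Definition identity_component {K : numFieldType} {n : nat}
    (H : set 'M[K]_n) : set 'M[K]_n :=
  connected_component H 1%:M.

Definition cartan_involution {R : realType} {n : nat} (G : lieGroupType R n)
    (g : {biscalar 'cV[R]_n}) (theta : 'M[R]_n) : Prop :=
  [/\ lie_hom G theta,
      theta *m theta = 1%:M,
      is_isometry g theta
    & forall u, u != 0 -> 0 < g u (theta *m u)].

Section RealSlice.
Variables (R : realType) (n m : nat).
Variables (G : lieGroupType R n) (GC : lieGroupType R[i] m).

(** [GC] as a real manifold: its complex charts are read in real coordinates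
    through ['cV[R[i]]_m = 'cV[R]_m + i 'cV[R]_m]. *)
Definition realify (z : 'cV[R[i]]_m) : 'cV[R]_(m + m) :=
  col_mx (map_mx (@complex.Re R) z) (map_mx (@complex.Im R) z).

Definition complexify (w : 'cV[R]_(m + m)) : 'cV[R[i]]_m :=
  \col_k (w (lshift m k) 0 +i* w (rshift m k) 0).

Definition local_map (a : chart R n G) (b : chart R[i] m GC) (iota : G -> GC)
    (x : 'cV[R]_n) : 'cV[R]_(m + m) :=
  realify (b (iota (chart_inv a x))).

Definition local_dom (a : chart R n G) (b : chart R[i] m GC) (iota : G -> GC)
    : set 'cV[R]_n :=
  [set x | chart_tgt a x /\ chart_dom b (iota (chart_inv a x))].

Definition immersive_hom (iota : G -> GC) : Prop :=
  [/\ forall x y, iota (x * y)%g = (iota x * iota y)%g,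
      continuous iota,
      forall a b, atlas a -> atlas b ->
        smooth_on (local_dom a b iota) (local_map a b iota)
    & forall a b, atlas a -> atlas b -> forall x, local_dom a b iota x ->
        injective (fun u => 'D_u (local_map a b iota) x)].

Definition lie_differential (iota : G -> GC) (u : 'cV[R]_n) : 'cV[R[i]]_m :=
  complexify ('D_u (local_map chart1 chart1 iota) (coord1 G)).

Definition embeds_real_form (j : 'cV[R]_n -> 'cV[R[i]]_m) : Prop :=
  [/\ forall (a : R) u v, j (a *: u + v) = a%:C *: j u + j v,
      forall u v, j (lie_bracket G u v) = lie_bracket GC (j u) (j v)
    & forall z, exists! p : 'cV[R]_n * 'cV[R]_n, z = j p.1 + 'i%C *: j p.2].

Definition real_slice (g : {biscalar 'cV[R]_n}) (gC : {biscalar 'cV[R[i]]_m})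
    (iota : G -> GC) : Prop :=
  [/\ is_metric g,
      is_metric gC,
      immersive_hom iota,
      embeds_real_form (lie_differential iota)
    & forall u v,
        gC (lie_differential iota u) (lie_differential iota v) = (g u v)%:C].

End RealSlice.

(* Main.v *)
(* [P = theta2 theta1] is an automorphism and an isometry, and it is self-adjoint
   and positive definite for the inner product [g(u, theta2 v)]. Hence it is
   diagonalizable with positive eigenvalues and has real powers [P^t]; comparing
   eigenvalues, each [P^t] preserves every bilinear operation that [P] preserves,
   so [t |-> P^t] is a path of isometric automorphisms starting at [1]. As
   [theta1 P theta1 = P^-1], also [theta1 P^t theta1 = P^-t], and [P^(1/2)]
   conjugates [theta1] into [P theta1 = theta2]. *)
Require Import Defs.
From HB Require Import structures.
From mathcomp Require Import all_boot all_order all_algebra.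
From mathcomp Require Import all_classical all_reals all_analysis.
From mathcomp Require Import complex ring.

Set Implicit Arguments.
Unset Strict Implicit.
Unset Printing Implicit Defensive.

Import Order.TTheory GRing.Theory Num.Theory.
Import numFieldNormedType.Exports.

Local Open Scope classical_set_scope.
Local Open Scope ring_scope.

(** * Bilinearity of the Lie bracket read in the chart at the identity *)

Section Bracket.
Variables (K : numFieldType) (n : nat) (G : lieGroupType K n).
Let c := coord1 G.

Definition mul_dom : set ('cV[K]_n * 'cV[K]_n) :=
  [set p | [/\ chart_tgt (chart1 : chart K n G) p.1,
    chart_tgt (chart1 : chart K n G) p.2 &
    chart_dom (chart1 : chart K n G)
      (chart_inv chart1 p.1 * chart_inv chart1 p.2)%g]].

Lemma smooth_mul_local : smooth_on mul_dom (@mul_local K n G).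
Proof. exact: lie_mul_smooth chart1_atlas chart1_atlas chart1_atlas. Qed.

Lemma chart_tgt_coord1 : chart_tgt (chart1 : chart K n G) c.
Proof. by exists 1%g => //; exact: chart1_dom. Qed.

Lemma chart_inv_coord1 : chart_inv (chart1 : chart K n G) c = 1%g.
Proof. by apply: chart_mapK; exact: chart1_dom. Qed.

Lemma nbhs_mul_dom : nbhs (c, c) mul_dom.
Proof.
have tc := chart_tgt_coord1.
have nt : nbhs c (chart_tgt (chart1 : chart K n G)).
  by apply: open_nbhs_nbhs; split=> //; exact: chart_tgt_open.
have c1 : (fun p : 'cV[K]_n * 'cV[K]_n => p.1) @ (c, c) --> c by exact: cvg_fst.
have c2 : (fun p : 'cV[K]_n * 'cV[K]_n => p.2) @ (c, c) --> c by exact: cvg_snd.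
have ic : chart_inv (chart1 : chart K n G) x @[x --> c] --> (1%g : G).
  by rewrite -[X in _ --> X]chart_inv_coord1; exact: chart_inv_cont.
have n3 : \forall p \near (c, c), chart_dom (chart1 : chart K n G)
      (chart_inv chart1 p.1 * chart_inv chart1 p.2)%g.
  have m : (chart_inv (chart1 : chart K n G) p.1 *
            chart_inv (chart1 : chart K n G) p.2)%g @[p --> (c, c)]
         --> (1 * 1 : G)%g.
    apply: (@cvg_comp _ _ _ (fun p : 'cV[K]_n * 'cV[K]_n =>
       (chart_inv (chart1 : chart K n G) p.1, chart_inv (chart1 : chart K n G) p.2))
       (fun p : G * G => (p.1 * p.2)%g)); last exact: (lie_mul_continuous (1%g, 1%g)).
    by apply: cvg_pair; [exact: cvg_comp c1 ic | exact: cvg_comp c2 ic].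
  have nd : nbhs (1 * 1 : G)%g (chart_dom (chart1 : chart K n G)).
    by rewrite mulg1; apply: open_nbhs_nbhs; split; [exact: chart_dom_open | exact: chart1_dom].
  exact: m nd.
near=> p; split; near: p; [exact: c1 nt|exact: c2 nt|exact: n3].
Unshelve. all: by end_near.
Qed.

Lemma mul_dom_coord1 : mul_dom (c, c).
Proof. exact: nbhs_singleton nbhs_mul_dom. Qed.

(** The inner derivative is fixed and differentiable, so only the linearity of its differential in
    the direction [(u, 0)] matters. *)
Lemma mixed_mul_linearl a u v w :
  mixed_mul G (a *: u + v) w = a *: mixed_mul G u w + mixed_mul G v w.
Proof.
have df : differentiable ('D_(0, w) (@mul_local K n G)) (c, c).
  by have [_ /(_ (0, w))[+ _]] := smooth_mul_local 2; apply; exact: mul_dom_coord1.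
rewrite /mixed_mul !deriveE// -linearP; congr ('d _ _ _).
by congr pair; rewrite /= scaler0 addr0.
Qed.

Lemma mixed_mul_linearr a u v w :
  mixed_mul G w (a *: u + v) = a *: mixed_mul G w u + mixed_mul G w v.
Proof.
have [df1 df2] := smooth_mul_local 2.
have df u' : derivable ('D_(0, u') (@mul_local K n G)) (c, c) (w, 0).
  by apply: diff_derivable; have [+ _] := df2 (0, u'); apply; exact: mul_dom_coord1.
rewrite /mixed_mul -deriveZ// -deriveD//; last exact: derivableZ.
(* The inner direction varies now: additivity of the inner derivative holds only on [mul_dom], but
   the outer derivative depends only on the germ at [(c, c)]. *)
apply: near_eq_derive; apply: filterS nbhs_mul_dom => p Up.
rewrite fctE /= !deriveE; [|exact: df1..].
rewrite -linearP; congr ('d _ _ _).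
by congr pair; rewrite /= scaler0 addr0.
Qed.

Lemma lie_bracketC u v : lie_bracket G u v = - lie_bracket G v u.
Proof. by rewrite /lie_bracket opprB. Qed.

Lemma lie_bracket_linearl a u v w :
  lie_bracket G (a *: u + v) w = a *: lie_bracket G u w + lie_bracket G v w.
Proof.
rewrite /lie_bracket (mixed_mul_linearl a u v w) (mixed_mul_linearr a u v w).
(* [mixed_mul] is generalized because unification would unfold the derivatives. *)
by move: (mixed_mul G) => f; rewrite scalerBr opprD addrACA.
Qed.

Lemma lie_bracket_linearr a u v w :
  lie_bracket G w (a *: u + v) = a *: lie_bracket G w u + lie_bracket G w v.
Proof.
have C := lie_bracketC; have L := lie_bracket_linearl a u v w.
by move: (lie_bracket G) C L => f C L; rewrite C L opprD -scalerN -!C.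
Qed.
End Bracket.

(** * Diagonalization of self-adjoint matrices over a real closed field *)

Lemma dvdp_prod_XsubC_exp (F : fieldType) (s : seq F) (q : {poly F}) :
  {in s, forall r, root q r} -> \prod_(r <- s) ('X - r%:P) %| q ^+ size s.
Proof.
elim: s => [|r s IHs] sq; first by rewrite big_nil expr0 dvdpp.
rewrite big_cons exprS dvdp_mul//.
  by rewrite dvdp_XsubCl sq// mem_head.
by apply: IHs => x xs; rewrite sq// in_cons xs orbT.
Qed.

Section SelfAdjoint.
Variables (R : rcfType) (n : nat) (b : 'rV[R]_n.+1 -> 'rV[R]_n.+1 -> R)
  (A : 'M[R]_n.+1).
Hypothesis b_linear : forall a u v w, b (a *: u + v) w = a * b u w + b v w.
Hypothesis bC : forall u v, b u v = b v u.
Hypothesis b_gt0 : forall u, u != 0 -> 0 < b u u.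
Let self_adjoint (B : 'M[R]_n.+1) := forall u v, b (u *m B) v = b u (v *m B).
Hypothesis A_sa : self_adjoint A.

Let bD u v w : b (u + v) w = b u w + b v w.
Proof. by rewrite -[u]scale1r b_linear scale1r mul1r. Qed.

Let b0 w : b 0 w = 0.
Proof. by apply: (addrI (b 0 w)); rewrite -bD !addr0. Qed.

Let bZ a u w : b (a *: u) w = a * b u w.
Proof. by rewrite -[a *: u]addr0 b_linear b0 addr0. Qed.

Let b_ge0 u : 0 <= b u u.
Proof. by have [->|/b_gt0/ltW//] := eqVneq u 0; rewrite b0. Qed.

(** As [A] is real, the real and imaginary parts of [v A = z v] can be taken separately, with
    [v = x + i y]. *)
Lemma complex_eigenvector_split (z : R[i]) :
  eigenvalue (map_mx (real_complex R) A) z ->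
  exists x y : 'rV[R]_n.+1, [/\ (x != 0) || (y != 0),
    x *m A = complex.Re z *: x - complex.Im z *: y &
    y *m A = complex.Im z *: x + complex.Re z *: y].
Proof.
move=> /eigenvalueP[v vA v0].
exists (map_mx (@complex.Re R) v), (map_mx (@complex.Im R) v); split.
- apply: contraNT v0; rewrite negb_or !negbK => /andP[/eqP/rowP x0 /eqP/rowP y0].
  apply/eqP/rowP => j; move: (x0 j) (y0 j); rewrite !mxE.
  by case: (v 0 j) => a c /= -> ->.
- apply/rowP => j; move/rowP/(_ j): vA => /(congr1 (@complex.Re R)); rewrite !mxE.
  (* Seen on [Rcomplex R], the real part is an additive map and commutes with the sum. *)
  rewrite -[complex.Re (\sum_i _)]/((@complex.Re R : Rcomplex R -> R) (\sum_i _)) raddf_sum.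
  move: (v 0 j) z => [a c] [a' c'] /= <-.
  by apply: eq_bigr => i _; rewrite !mxE; case: (v 0 i) => e f /=; ring.
- apply/rowP => j; move/rowP/(_ j): vA => /(congr1 (@complex.Im R)); rewrite !mxE.
  rewrite -[complex.Im (\sum_i _)]/((@complex.Im R : Rcomplex R -> R) (\sum_i _)) raddf_sum.
  move: (v 0 j) z => [a c] [a' c'] /= e; rewrite addrC -[RHS]e.
  by apply: eq_bigr => i _; rewrite !mxE; case: (v 0 i) => k f /=; ring.
Qed.

(** Comparing [b (x A) y] with [b x (y A)] gives [Im z * (b x x + b y y) = 0], and the second factor
    is positive. *)
Lemma eigenvalue_real (z : R[i]) :
  eigenvalue (map_mx (real_complex R) A) z -> z = (complex.Re z)%:C%C.
Proof.
move=> /complex_eigenvector_split[x [y [xy0 Ax Ay]]].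
have : complex.Im z * (b x x + b y y) = 0.
  have := A_sa x y; rewrite Ax Ay [b x _]bC -scaleNr !bD !bZ (bC y x).
  by move/eqP; rewrite -subr_eq0 => /eqP e; apply: oppr_inj; rewrite oppr0 -e; ring.
move/eqP; rewrite mulf_eq0 => /orP[/eqP zi|].
  by apply/eqP; rewrite eq_complex/= zi !eqxx.
rewrite paddr_eq0// => /andP[/eqP bx /eqP by'].
by case/orP: xy0 => /b_gt0; rewrite ?bx ?by' ltxx.
Qed.

(** The polynomial splits over [R[i]]; its roots are real, so the factorization descends to [R]. *)
Lemma char_poly_split_real : exists s : seq R, char_poly A = \prod_(r <- s) ('X - r%:P).
Proof.
have [s es] := closed_field_poly_normal (char_poly (map_mx (real_complex R) A)).
rewrite (monicP (char_poly_monic _)) scale1r in es.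
exists (map (@complex.Re R) s).
apply: (map_poly_inj (real_complex R)).
rewrite map_char_poly es rmorph_prod/= big_map big_seq [RHS]big_seq.
apply: eq_bigr => z zs; rewrite rmorphB/= map_polyX map_polyC/= -eigenvalue_real//.
by rewrite eigenvalue_root_char es root_prod_XsubC.
Qed.

Lemma self_adjoint_horner (p : {poly R}) : self_adjoint (horner_mx A p).
Proof.
elim/poly_ind: p => [|p c IHp] u v.
  by rewrite rmorph0 !mulmx0 b0 bC b0.
rewrite rmorphD rmorphM/= horner_mx_X horner_mx_C !mulmxDr.
rewrite !mul_mx_scalar bD [b u _]bC bD !bZ (bC v u); congr (_ + _).
have cAH : horner_mx A p *m A = A *m horner_mx A p by exact: comm_horner_mx.
by rewrite -[_ * A]/(_ *m A) [in RHS]cAH !mulmxA A_sa [LHS]IHp bC.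
Qed.

(** If [B^2 = 0] then [b (u B) (u B) = b u (u B^2) = 0]. Exponents [2 ^ k] let the induction pass
    from [B] to the self-adjoint [B^2]. *)
Lemma self_adjoint_nilpotent B k : self_adjoint B -> B ^+ (2 ^ k) = 0 -> B = 0.
Proof.
elim: k B => [|k IHk] B saB; first by rewrite expr1.
rewrite expnS exprM => /IHk B2.
have {B2}: B ^+ 2 = 0 by apply: B2 => u v; rewrite expr2 !mulmxA !saB.
rewrite expr2 => B2; apply/row_matrixP => i; rewrite row0.
apply/eqP; apply: contraT => /b_gt0.
by rewrite rowE saB -mulmxA [B *m B]B2 mulmx0 bC b0 ltxx.
Qed.

Lemma self_adjoint_diagonalizable :
  exists2 V : 'M[R]_n.+1, V \in unitmx & exists d : 'rV_n.+1, V *m A = diag_mx d *m V.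
Proof.
(* Some power of the squarefree part [q] of the characteristic polynomial kills
   [A], hence [q] does, as [q(A)] is self-adjoint. *)
have [s es] := char_poly_split_real.
have : exists2 V : 'M[R]_n.+1, V \in unitmx & similar_diag V A.
  apply/diagonalizableP; exists (undup s); first exact: undup_uniq.
  set q := \prod_(x <- undup s) ('X - x%:P).
  apply: mxminpoly_min; apply: (@self_adjoint_nilpotent _ (size s)).
    exact: self_adjoint_horner.
  rewrite -rmorphXn/=.
  suff /dvdpP[r ->] : char_poly A %| q ^+ (2 ^ size s).
    by rewrite rmorphM/= Cayley_Hamilton mulr0.
  (* The exponent [size s] already suffices; it is enlarged to a power of 2 to fit the nilpotency
     lemma. *)
  rewrite es; apply: (@dvdp_trans _ (q ^+ size s)); last first.
    by apply: dvdp_exp2l; rewrite ltnW// ltn_expl.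
  by apply: dvdp_prod_XsubC_exp => x xs; rewrite root_prod_XsubC mem_undup.
move=> [V Vu /diagonalizable_forPex[d /(simmxP Vu) e]].
by exists V => //; exists d.
Qed.
End SelfAdjoint.

(** * Real powers of a matrix with an eigenbasis of positive eigenvalues *)

Lemma col_mulmx (S : pzSemiRingType) m n p (A : 'M[S]_(m, n)) (B : 'M[S]_(n, p)) j :
  col j (A *m B) = A *m col j B.
Proof. by rewrite !colE mulmxA. Qed.

Lemma continuous_mx (T S : topologicalType) m n (f : T -> 'M[S]_(m, n)) :
  (forall i j, continuous (fun t => f t i j)) -> continuous f.
Proof.
move=> cf t A [P nP PA]; apply: (filterS (P := [set s | forall i j, P i j (f s i j)])).
  by move=> s Ps; exact: PA.
apply: filter_forall => i; apply: filter_forall => j.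
exact: (cf i j t _ (nP i j)).
Qed.

Section EigenbasisPower.
Variables (R : realType) (n : nat) (W : 'M[R]_n) (d : 'rV[R]_n) (P : 'M[R]_n).
Hypothesis Wu : W \in unitmx.
Hypothesis d_gt0 : forall i, 0 < d 0 i.
Hypothesis PW : P *m W = W *m diag_mx d.

Lemma eigenbasis_ind (Q : 'cV[R]_n -> Prop) :
  Q 0 -> (forall a u v, Q u -> Q v -> Q (a *: u + v)) ->
  (forall j, Q (col j W)) -> forall u, Q u.
Proof.
move=> Q0 Qlin QW u; have -> : u = \sum_j (invmx W *m u) j 0 *: col j W.
  rewrite -[LHS](mulKVmx Wu); apply/colP => i; rewrite mxE summxE.
  by apply: eq_bigr => j _; rewrite !mxE mulrC.
by elim/big_rec: _ => // j x _ Qx; exact: Qlin.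
Qed.

(** This is [P^t], acting on the eigenvector [col j W] by the scalar [d_j^t]. *)
Definition mxpow (t : R) : 'M[R]_n :=
  W *m diag_mx (\row_j (d 0 j `^ t)) *m invmx W.

Lemma mxpow0 : mxpow 0 = 1%:M.
Proof.
rewrite /mxpow; have -> : diag_mx (\row_j (d 0 j `^ 0)) = 1%:M :> 'M[R]_n.
  by apply/matrixP => i j; rewrite !mxE powRr0.
by rewrite mulmx1 mulmxV.
Qed.

Lemma mxpow1 : mxpow 1 = P.
Proof.
rewrite /mxpow; have -> : \row_j (d 0 j `^ 1) = d.
  by apply/rowP => j; rewrite mxE powRr1// ltW.
by rewrite -PW mulmxK.
Qed.

Lemma mxpowD s t : mxpow (s + t) = mxpow s *m mxpow t.
Proof.
rewrite /mxpow !mulmxA mulmxKV// -[in RHS](mulmxA W) mulmx_diag.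
congr (_ *m diag_mx _ *m _); apply/rowP => j.
by rewrite !mxE powRD// (gt_eqF (d_gt0 j)) implybT.
Qed.

Lemma mxpowN t : mxpow t *m mxpow (- t) = 1%:M.
Proof. by rewrite -mxpowD subrr mxpow0. Qed.

Lemma mxpow_unit t : mxpow t \in unitmx.
Proof. by case/mulmx1_unit: (mxpowN t). Qed.

(** In coordinates [c] of [u] on the eigenbasis, [d_j c_j = nu c_j], so [d_j = nu] wherever [c_j] is
    nonzero. The vector [u] need not belong to the basis. *)
Lemma mxpow_eigenvector (nu : R) (u : 'cV[R]_n) t :
  P *m u = nu *: u -> mxpow t *m u = (nu `^ t) *: u.
Proof.
move=> Pu; have [c uE] : exists c, u = W *m c.
  by exists (invmx W *m u); rewrite mulKVmx.
have dc j : d 0 j * c j 0 = nu * c j 0.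
  have : diag_mx d *m c = nu *: c.
    by rewrite -[LHS](mulKmx Wu) (mulmxA W) -PW -mulmxA -uE Pu -scalemxAr uE mulKmx.
  by move/colP/(_ j); rewrite mul_diag_mx !mxE.
rewrite /mxpow uE -!mulmxA mulKmx// scalemxAr; congr (_ *m _).
apply/colP => j; rewrite mul_diag_mx !mxE.
have [->|cj0] := eqVneq (c j 0) 0; first by rewrite !mulr0.
by rewrite (mulIf cj0 (dc j)).
Qed.

Lemma eigenbasisP j : P *m col j W = d 0 j *: col j W.
Proof.
rewrite -col_mulmx PW mul_mx_diag; apply/colP => i.
by rewrite !mxE mulrC.
Qed.

Lemma mxpow_continuous : continuous mxpow.
Proof.
apply: continuous_mx => i j t.
have -> : (fun s => mxpow s i j) =
    fun s => \sum_k W i k * d 0 k `^ s * invmx W k j.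
  apply/funext => s; rewrite mxE; apply: eq_bigr => k _.
  by rewrite mul_mx_diag !mxE.
apply: cvg_big => [|k _]; first exact: add_continuous.
apply: cvgMl; apply: cvgMr.
(* A positive base excludes the special case of [powR] at 0 and leaves [exp (s * ln d_k)]. *)
rewrite /powR gt_eqF//=.
apply: (@cvg_comp _ _ _ (fun s : R => s * ln (d 0 k)) expR).
  by apply: cvgMl; exact: cvg_id.
exact: continuous_expR.
Qed.

(** For basis eigenvectors [w_j], [w_k], [P] scales [f w_j w_k] by [d_j d_k], so [P^t] scales it by
    [(d_j d_k)^t = d_j^t d_k^t]. *)
Lemma mxpow_preserves_product (f : 'cV[R]_n -> 'cV[R]_n -> 'cV[R]_n) t :
  (forall a u v w, f (a *: u + v) w = a *: f u w + f v w) ->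
  (forall a u v w, f w (a *: u + v) = a *: f w u + f w v) ->
  (forall u v, f (P *m u) (P *m v) = P *m f u v) ->
  forall u v, f (mxpow t *m u) (mxpow t *m v) = mxpow t *m f u v.
Proof.
move=> fl fr fP.
have f0l w : f 0 w = 0 by have := fl (-1) 0 0 w; rewrite scaler0 addr0 scaleN1r addNr.
have f0r w : f w 0 = 0 by have := fr (-1) 0 0 w; rewrite scaler0 addr0 scaleN1r addNr.
have fZ a c u v : f (a *: u) (c *: v) = (a * c) *: f u v.
  by rewrite -[a *: u]addr0 -[c *: v]addr0 fl f0l fr f0r !addr0 scalerA.
apply: eigenbasis_ind => [v|a u v IHu IHv w|j].
- by rewrite mulmx0 !f0l mulmx0.
- by rewrite mulmxDr -scalemxAr !fl IHu IHv mulmxDr -scalemxAr.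
apply: eigenbasis_ind => [|a u v IHu IHv|k].
- by rewrite mulmx0 !f0r mulmx0.
- by rewrite mulmxDr -scalemxAr !fr IHu IHv mulmxDr -scalemxAr.
rewrite !(mxpow_eigenvector _ (eigenbasisP _)) fZ -powRM ?ltW//.
by rewrite -mxpow_eigenvector// -fP !eigenbasisP fZ.
Qed.

(** On basis eigenvectors [d_j d_k g(w_j, w_k) = g(w_j, w_k)]: either the pairing vanishes or
    [d_j d_k = 1], and then [(d_j d_k)^t = 1]. *)
Lemma mxpow_isometry (g : {biscalar 'cV[R]_n}) t :
  (forall u v, g (P *m u) (P *m v) = g u v) ->
  forall u v, g (mxpow t *m u) (mxpow t *m v) = g u v.
Proof.
move=> gP.
apply: eigenbasis_ind => [v|a u v IHu IHv w|j].
- by rewrite mulmx0 !linear0l.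
- by rewrite mulmxDr -scalemxAr !linearPl IHu IHv.
apply: eigenbasis_ind => [|a u v IHu IHv|k].
- by rewrite mulmx0 !linear0r.
- by rewrite mulmxDr -scalemxAr !linearPr IHu IHv.
have gZ a c u v : g (a *: u) (c *: v) = a * c * g u v.
  by rewrite linearZl_LR linearZr_LR /= mulrA.
rewrite !(mxpow_eigenvector _ (eigenbasisP _)) gZ -powRM ?ltW//.
have := gP (col j W) (col k W); rewrite !eigenbasisP gZ.
have [->|g0] := eqVneq (g (col j W) (col k W)) 0; first by rewrite !mulr0.
by rewrite -[X in _ = X -> _]mul1r => /(mulIf g0)->; rewrite powR1 mul1r.
Qed.

(** The hypothesis makes [theta w_j] satisfy the eigenvector equation of [P] for [d_j^-1], whence
    [P^t theta = theta P^-t] on the basis. *)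
Lemma mxpow_inverted theta t :
  P *m theta *m P = theta ->
  mxpow t *m theta *m mxpow t = theta.
Proof.
move=> PtP.
have e : mxpow t *m theta = theta *m mxpow (- t).
  apply: (can_inj (mulmxK Wu)); apply/matrixP => i j.
  suff /colP/(_ i) : col j (mxpow t *m theta *m W) = col j (theta *m mxpow (- t) *m W).
    by rewrite [LHS]mxE [RHS]mxE.
  rewrite !col_mulmx -(mulmxA (mxpow t)) -(mulmxA theta).
  rewrite (mxpow_eigenvector _ (eigenbasisP j)) -scalemxAr.
  rewrite -mulN1r powRrM powR_inv1 ?ltW//; apply: mxpow_eigenvector.
  rewrite -[in RHS]PtP -!mulmxA eigenbasisP -!scalemxAr scalerA mulVf ?scale1r//.
  by rewrite gt_eqF.
by rewrite e -mulmxA -mxpowD addNr mxpow0 mulmx1.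
Qed.
End EigenbasisPower.

(** * Positive self-adjoint operators, and paths in matrix groups *)

Lemma positive_self_adjoint_diagonalizable (R : rcfType) (n : nat)
    (b : 'cV[R]_n -> 'cV[R]_n -> R) (P : 'M[R]_n) :
  (forall a u v w, b (a *: u + v) w = a * b u w + b v w) ->
  (forall u v, b u v = b v u) ->
  (forall u, u != 0 -> 0 < b u u) ->
  (forall u v, b (P *m u) v = b u (P *m v)) ->
  (forall u, u != 0 -> 0 < b (P *m u) u) ->
  exists2 W : 'M[R]_n, W \in unitmx &
    exists2 d : 'rV[R]_n, (forall i, 0 < d 0 i) & P *m W = W *m diag_mx d.
Proof.
case: n b P => [|n] b P bl bC b_gt0 saP P_gt0.
  exists 1%:M; rewrite ?unitmx1//; exists 0; first by case.
  by apply/matrixP; case.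
(* The spectral result concerns row vectors, so it is applied to [P^T] with the form transported by
   transposition. *)
pose br (u v : 'rV[R]_n.+1) := b u^T v^T.
have [V Vu [d VP]] : exists2 V : 'M[R]_n.+1, V \in unitmx &
    exists d : 'rV_n.+1, V *m P^T = diag_mx d *m V.
  apply: (@self_adjoint_diagonalizable _ _ br) => [a u v w|u v|u u0|u v].
  - by rewrite /br linearP bl.
  - exact: bC.
  - by apply: b_gt0; rewrite -trmx0 (inj_eq trmx_inj).
  - by rewrite /br !trmx_mul trmxK saP.
have PW : P *m V^T = V^T *m diag_mx d.
  by apply: trmx_inj; rewrite !trmx_mul tr_diag_mx trmxK.
have VTu : V^T \in unitmx by rewrite unitmx_tr.
exists V^T => //; exists d => // i; set w := col i V^T.
have w0 : w != 0.
  apply: contraTneq Vu => w0; rewrite -unitmx_tr; apply/negP => u.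
  have := congr1 (mulmx (invmx V^T)) w0; rewrite -col_mulmx mulVmx// mulmx0.
  by move/colP/(_ i); rewrite !mxE eqxx => /eqP; rewrite oner_eq0.
(* Positivity of [d_i] comes from [b (P w) w = d_i * b w w]; the added [+ 0] below gives the shape
   expected by [bl]. *)
have := P_gt0 _ w0; rewrite /w -col_mulmx PW.
have -> : col i (V^T *m diag_mx d) = d 0 i *: w + 0.
  by apply/colP => k; rewrite mul_mx_diag !mxE addr0 mulrC.
have b0 : b 0 w = 0 by have := bl (-1) 0 0 w; rewrite scaler0 addr0 mulN1r addNr.
by rewrite bl b0 addr0 pmulr_lgt0// b_gt0.
Qed.

(** The range of [c] is the continuous image of the connected line, lies in [H] and contains 1. *)
Lemma continuous_path_identity_component (R : realType) (n : nat) (H : set 'M[R]_n)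
    (c : R -> 'M[R]_n) :
  continuous c -> c 0 = 1%:M -> (forall t, H (c t)) ->
  forall t, identity_component H (c t).
Proof.
move=> cc c0 cH t.
apply: (@connected_component_max _ H (range c)) => //.
- by exists 0.
- by move=> _ [s _ <-].
- apply: connected_continuous_connected; first exact/connected_intervalP.
  by apply: continuous_subspaceT.
Qed.

(** * Conjugation of the two Cartan involutions *)

Theorem theorem4p1 (R : realType) (n m : nat)
    (G : lieGroupType R n) (GC : lieGroupType R[i] m)
    (g : {biscalar 'cV[R]_n}) (gC : {biscalar 'cV[R[i]]_m})
    (iota : G -> GC) (hslice : real_slice g gC iota)
    (p q : nat) (hsig : has_signature g p q)
    (theta1 theta2 : 'M[R]_n)
    (htheta1 : cartan_involution G g theta1)
    (htheta2 : cartan_involution G g theta2) :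
  exists2 phi : 'M[R]_n,
    (identity_component (lie_aut G) `&`
     identity_component (isometry_group g)) phi
    & phi *m theta1 *m invmx phi = theta2.
Proof.
have [[gC' _] _ _ _ _] := hslice.
have [hom1 th1 iso1 pos1] := htheta1; have [hom2 th2 iso2 pos2] := htheta2.
(* An isometric involution is self-adjoint for [g]. *)
have thC theta u v : theta *m theta = 1%:M -> is_isometry g theta ->
    g u (theta *m v) = g (theta *m u) v.
  by move=> th iso; rewrite -[LHS]iso mulmxA th mul1mx.
pose P := theta2 *m theta1.
have [|||||W Wu [d d_gt0 PW]] := @positive_self_adjoint_diagonalizable R n
    (fun u v => g u (theta2 *m v)) P.
- by move=> a u v w; rewrite linearPl.
- by move=> u v; rewrite thC// gC'.
- exact: pos2.
(* As [theta2 P = theta1], both sides equal [g u (theta1 v)]. *)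
- by move=> u v; rewrite /P -mulmxA iso2 -thC// !mulmxA th2 mul1mx.
(* The value is [g (theta1 u) u], so positivity comes from [theta1]. *)
- by move=> u u0; rewrite /P -mulmxA iso2 gC' pos1.
have homP u v : lie_bracket G (P *m u) (P *m v) = P *m lie_bracket G u v.
  by rewrite /P -!mulmxA hom2 hom1.
have isoP u v : g (P *m u) (P *m v) = g u v by rewrite /P -!mulmxA iso2 iso1.
pose path := mxpow W d.
have path0 : path 0 = 1%:M by exact: mxpow0.
have path_cont : continuous path by exact: mxpow_continuous.
have Pth1P : P *m theta1 *m P = theta1.
  by rewrite /P -(mulmxA theta2) th1 mulmx1 mulmxA th2 mul1mx.
have pathu t : path t \in unitmx by exact: mxpow_unit.
exists (path 2^-1).
  split; apply: continuous_path_identity_component => // t; split=> //.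
    apply: (mxpow_preserves_product Wu d_gt0 PW) => //.
    - exact: lie_bracket_linearl.
    - exact: lie_bracket_linearr.
  exact: (mxpow_isometry Wu d_gt0 PW _ isoP).
have half : 2^-1 + 2^-1 = 1 :> R by rewrite [RHS]splitr mul1r.
(* With [S = P^(1/2)] and [theta1 = S theta1 S], the conjugate becomes
   [S S theta1 S S^-1 = P theta1]. *)
rewrite -[in LHS](mxpow_inverted Wu d_gt0 PW 2^-1 Pth1P) -/path mulmxA mulmxK//.
rewrite mulmxA -mxpowD// half (mxpow1 Wu d_gt0 PW).
by rewrite /P -mulmxA th1 mulmx1.
Qed.
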